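(* Consider an open quantum system on a finite-dimensional Hilbert space $\mathcal H$ with Hamiltonian $H$ and coupling operators $L_1,\dots,L_K$, and let $V$ be a Lyapunov operator of the system (commuting with $H$). Suppose that either (Condition ES) there is $c>0$ with $\mathcal G(V)\le -cV$, or (Condition DS) $\mathcal G(V)\le0$ and there is $c>0$ with $cV\le\mathfrak D(V)$. Then for every initial density state the state trajectory $\rho_t$ converges to $Z_V$, i.e. every limit point of $\rho_t$ as $t\to\infty$ lies in $Z_V$.
   Context: The density state (positive semidefinite, trace one) evolves by $\dot\rho_t=-i[H,\rho_t]+\sum_{k=1}^K\big(L_k\rho_tL_k^\dagger-\tfrac12L_k^\dagger L_k\rho_t-\tfrac12\rho_tL_k^\dagger L_k\big)$. Standing assumption: the observables considered commute with $H$; for such $X$ the generator is $\mathcal G(X)=\sum_{k=1}^K\big(L_k^\dagger XL_k-\tfrac12L_k^\dagger L_kX-\tfrac12XL_k^\dagger L_k\big)$ and $\frac{d}{dt}\operatorname{tr}(X\rho_t)=\operatorname{tr}(\mathcal G(X)\rho_t)$. A Lyapunov operator is a self-adjoint $V\ge0$ whose smallest eigenvalue is $0$ and with $\mathcal G(V)\le0$. The dissipation functional is $\mathfrak D(X)=\mathcal G(X^\dagger X)-\mathcal G(X^\dagger)X-X^\dagger\mathcal G(X)$; for self-adjoint $V$ this equals $\sum_k[L_k^\dagger,V][V,L_k]$. $Z_V=\{\rho \text{ density state}:\operatorname{tr}(V\rho)=0\}$; convergence of states means convergence of $\operatorname{tr}(\rho Y)$ for all operators $Y$. *)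

(* Defs.v *)
From HB Require Import structures.
From mathcomp Require Import all_boot all_order all_algebra.
From mathcomp Require Import all_classical all_reals all_analysis.
From mathcomp Require Import complex.
Set Implicit Arguments. Unset Strict Implicit. Unset Printing Implicit Defensive.
Import Order.TTheory GRing.Theory Num.Theory.
Import numFieldNormedType.Exports.
Local Open Scope classical_set_scope.
Local Open Scope ring_scope.

Section QDefs.
Variable R : realType.
Local Notation C := (R[i]).

Definition cconj (z : C) : C := Complex (complex.Re z) (- complex.Im z).
Definition adjoint (m p : nat) (A : 'M[C]_(m, p)) : 'M[C]_(p, m) :=
  \matrix_(i, j) cconj (A j i).

Variable n : nat.

(* positive semidefinite: <x, A x> >= 0 for every vector x (order of R[i]:
   0 <= z means z is real and nonnegative) *)
Definition psd_op (A : 'M[C]_n) : Prop :=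
  forall x : 'cV[C]_n, 0 <= (adjoint x *m A *m x) 0 0.

Definition op_le (A B : 'M[C]_n) : Prop := psd_op (B - A).

Definition density_state (rho : 'M[C]_n) : Prop := psd_op rho /\ \tr rho = 1.

Definition chalf : C := 2^-1.

Definition lindblad (K : nat) (H : 'M[C]_n) (L : 'I_K -> 'M[C]_n)
    (rho : 'M[C]_n) : 'M[C]_n :=
  - (Complex 0 1) *: (H *m rho - rho *m H)
  + \sum_(k < K) (L k *m rho *m adjoint (L k)
                  - chalf *: (adjoint (L k) *m L k *m rho)
                  - chalf *: (rho *m (adjoint (L k) *m L k))).

(* the generator G(X) (Heisenberg picture, for X commuting with H) *)
Definition lgen (K : nat) (L : 'I_K -> 'M[C]_n) (X : 'M[C]_n) : 'M[C]_n :=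
  \sum_(k < K) (adjoint (L k) *m X *m L k
                - chalf *: (adjoint (L k) *m L k *m X)
                - chalf *: (X *m (adjoint (L k) *m L k))).

Definition ldiss (K : nat) (L : 'I_K -> 'M[C]_n) (X : 'M[C]_n) : 'M[C]_n :=
  lgen L (adjoint X *m X) - lgen L (adjoint X) *m X - adjoint X *m lgen L X.

Definition min_eigenvalue_zero (V : 'M[C]_n) : Prop :=
  eigenvalue V 0 /\ (forall a : C, eigenvalue V a -> 0 <= a).

Definition lyapunov (K : nat) (L : 'I_K -> 'M[C]_n) (V : 'M[C]_n) : Prop :=
  [/\ V = adjoint V, psd_op V, min_eigenvalue_zero V & op_le (lgen L V) 0].

Definition ZV (V : 'M[C]_n) (rho : 'M[C]_n) : Prop :=
  density_state rho /\ \tr (V *m rho) = 0.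

Definition solves_lindblad (K : nat) (H : 'M[C]_n) (L : 'I_K -> 'M[C]_n)
    (rho : R -> 'M[C]_n) : Prop :=
  forall (t : R) (i j : 'I_n),
    is_derive t 1 (fun s => complex.Re (rho s i j)) (complex.Re (lindblad H L (rho t) i j)) /\
    is_derive t 1 (fun s => complex.Im (rho s i j)) (complex.Im (lindblad H L (rho t) i j)).

(* sigma is a limit point of rho_t as t -> oo (convergence of all entries,
   equivalently of tr(rho Y) for all Y) *)
Definition traj_limit_point (rho : R -> 'M[C]_n) (sigma : 'M[C]_n) : Prop :=
  exists u : nat -> R,
    (u @ \oo --> +oo) /\
    forall i j : 'I_n,
      ((fun k => complex.Re (rho (u k) i j)) @ \oo --> complex.Re (sigma i j)) /\
      ((fun k => complex.Im (rho (u k) i j)) @ \oo --> complex.Im (sigma i j)).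

End QDefs.

(* Main.v *)
Require Import Defs.
From HB Require Import structures.
From mathcomp Require Import all_boot all_order all_algebra.
From mathcomp Require Import all_classical all_reals all_analysis.
From mathcomp Require Import complex.
From mathcomp Require Import spectral ring lra.
Import Order.TTheory GRing.Theory Num.Theory.
Import numFieldNormedType.Exports.
Local Open Scope ring_scope.
Set Implicit Arguments. Unset Strict Implicit. Unset Printing Implicit Defensive.

(** The flow preserves density states: with [A = - i H - 1/2 sum_k L_k^* L_k],
    the map [M |-> (1 + h A) M (1 + h A)^* + h sum_k L_k M L_k^*] is positive
    and differs from [M + h lindblad M] by [h^2 A M A^*]. Hence
    [rho_t + e exp(k t) 1] cannot lose positivity for suitable [k] and any
    [e > 0]; let [e] tend to [0].

    Let [sigma] be a limit point and [l = tr(V sigma)]. Since [tr(V rho_t)] is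
    nonincreasing, it stays above [l]. If some [X] commuting with [H] satisfies
    [G(X) >= c V - b 1], then [tr(X rho_t)] grows at rate at least [c l - b]
    while staying bounded, so [c l <= b]. Under ES take [X = - V] and [b = 0].
    Under DS take [X = V^2 - s^2 V]: with [W = - G(V) >= 0], expanding
    [(s - V/s) W (s - V/s) >= 0] gives [b = O(s^-2)], and [s] is arbitrary. *)

Local Open Scope complex_scope.

(** * Algebra of the adjoint *)

Lemma ReZ (R : realType) (r : R) (z : R[i]) :
  complex.Re (r%:C * z) = r * complex.Re z.
Proof. by case: z => a b /=; rewrite mul0r subr0. Qed.

Lemma adjointE (R : realType) (m p : nat) (A : 'M[R[i]]_(m, p)) :
  adjoint A = map_mx Num.conj A^T.
Proof. by apply/matrixP => i j; rewrite !mxE; case: (A j i). Qed.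

Lemma adjointK (R : realType) (m p : nat) (A : 'M[R[i]]_(m, p)) :
  adjoint (adjoint A) = A.
Proof. by rewrite !adjointE trmxCK. Qed.

Lemma adjointM (R : realType) (m p q : nat) (A : 'M[R[i]]_(m, p))
    (B : 'M[R[i]]_(p, q)) : adjoint (A *m B) = adjoint B *m adjoint A.
Proof. by rewrite !adjointE trmx_mul map_mxM. Qed.

Lemma adjointD (R : realType) (m p : nat) (A B : 'M[R[i]]_(m, p)) :
  adjoint (A + B) = adjoint A + adjoint B.
Proof. by rewrite !adjointE linearD map_mxD. Qed.

Lemma adjointZ (R : realType) (m p : nat) (z : R[i]) (A : 'M[R[i]]_(m, p)) :
  adjoint (z *: A) = conjc z *: adjoint A.
Proof. by rewrite !adjointE linearZ map_mxZ. Qed.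

Lemma adjointN (R : realType) (m p : nat) (A : 'M[R[i]]_(m, p)) :
  adjoint (- A) = - adjoint A.
Proof. by rewrite !adjointE linearN map_mxN. Qed.

Lemma adjoint_sum (R : realType) (m p k : nat) (F : 'I_k -> 'M[R[i]]_(m, p)) :
  adjoint (\sum_i F i) = \sum_i adjoint (F i).
Proof.
rewrite adjointE linear_sum raddf_sum.
by apply: eq_bigr => i _; rewrite adjointE.
Qed.

Lemma adjoint1 (R : realType) (n : nat) :
  adjoint (1%:M : 'M[R[i]]_n) = 1%:M.
Proof. by rewrite adjointE trmx1 map_mx1. Qed.

(** * Real trace pairing and quadratic forms *)

(** Taking the real part makes observables real functions of time, open to real calculus; [tr_rtr]
    recovers the complex trace. *)
Definition rtr (R : realType) (n : nat) (Y M : 'M[R[i]]_n) : R :=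
  complex.Re (\tr (Y *m M)).

Definition qf (R : realType) (n : nat) (x : 'cV[R[i]]_n) (M : 'M[R[i]]_n) : R :=
  complex.Re ((adjoint x *m M *m x) 0 0).

(** Positivity of the Hermitian part only. It is a family of real inequalities; [psd_opP] expresses
    [psd_op] through it. *)
Definition accretive (R : realType) (n : nat) (M : 'M[R[i]]_n) : Prop :=
  forall x : 'cV[R[i]]_n, 0 <= qf x M.

Lemma rtrC (R : realType) (n : nat) (Y M : 'M[R[i]]_n) : rtr Y M = rtr M Y.
Proof. by rewrite /rtr mxtrace_mulC. Qed.

Lemma rtrDl (R : realType) (n : nat) (Y Z M : 'M[R[i]]_n) :
  rtr (Y + Z) M = rtr Y M + rtr Z M.
Proof. by rewrite /rtr mulmxDl linearD raddfD. Qed.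

Lemma rtrNl (R : realType) (n : nat) (Y M : 'M[R[i]]_n) :
  rtr (- Y) M = - rtr Y M.
Proof. by rewrite /rtr mulNmx linearN raddfN. Qed.

Lemma rtrZl (R : realType) (n : nat) (r : R) (Y M : 'M[R[i]]_n) :
  rtr (r%:C *: Y) M = r * rtr Y M.
Proof. by rewrite /rtr -scalemxAl linearZ; exact: ReZ. Qed.

Lemma rtr_suml (R : realType) (n k : nat) (F : 'I_k -> 'M[R[i]]_n)
    (M : 'M[R[i]]_n) : rtr (\sum_i F i) M = \sum_i rtr (F i) M.
Proof.
by rewrite /rtr mulmx_suml (raddf_sum (@mxtrace _ n)) (raddf_sum (@complex.Re R)).
Qed.

Lemma quad_form_tr (R : realType) (n : nat) (x : 'cV[R[i]]_n)
    (M : 'M[R[i]]_n) :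
  (adjoint x *m M *m x) 0 0 = \tr (M *m (x *m adjoint x)).
Proof. by rewrite mulmxA mxtrace_mulC mulmxA [RHS]big_ord1. Qed.

Lemma qf_rtr (R : realType) (n : nat) (x : 'cV[R[i]]_n) (M : 'M[R[i]]_n) :
  qf x M = rtr M (x *m adjoint x).
Proof. by rewrite /qf quad_form_tr. Qed.

Lemma qfD (R : realType) (n : nat) (x : 'cV[R[i]]_n) (Y Z : 'M[R[i]]_n) :
  qf x (Y + Z) = qf x Y + qf x Z.
Proof. by rewrite !qf_rtr rtrDl. Qed.

Lemma qfN (R : realType) (n : nat) (x : 'cV[R[i]]_n) (Y : 'M[R[i]]_n) :
  qf x (- Y) = - qf x Y.
Proof. by rewrite !qf_rtr rtrNl. Qed.

Lemma qfZ (R : realType) (n : nat) (x : 'cV[R[i]]_n) (r : R)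
    (Y : 'M[R[i]]_n) : qf x (r%:C *: Y) = r * qf x Y.
Proof. by rewrite !qf_rtr rtrZl. Qed.

Lemma qf_conj (R : realType) (n : nat) (x : 'cV[R[i]]_n) (B M : 'M[R[i]]_n) :
  qf x (B *m M *m adjoint B) = qf (adjoint B *m x) M.
Proof. by rewrite /qf adjointM adjointK !mulmxA. Qed.

Lemma qf_i (R : realType) (n : nat) (x : 'cV[R[i]]_n) (M : 'M[R[i]]_n) :
  qf x ('i *: M) = - complex.Im ((adjoint x *m M *m x) 0 0).
Proof. by rewrite /qf -scalemxAr -scalemxAl mxE mulrC ReiNIm. Qed.

(** The form of ['i *: M] is minus the imaginary part of the form of [M], so nonnegativity with both
    signs makes the form of [M] real. *)
Lemma psd_opP (R : realType) (n : nat) (M : 'M[R[i]]_n) :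
  psd_op M <-> [/\ accretive M, accretive ('i *: M) & accretive (- ('i *: M))].
Proof.
split=> [pM|[aM iM NiM] x].
- have h x := pM x; split=> x; move: (h x); rewrite lecE /= => /andP[/eqP Im0 Re0] //.
    by rewrite qf_i Im0 oppr0.
  by rewrite qfN qf_i Im0 !oppr0.
rewrite lecE [X in _ && X]aM andbT.
have := iM x; have := NiM x; rewrite qfN !qf_i opprK oppr_ge0 => h1 h2.
by rewrite eq_le h1 h2.
Qed.

(** * Spectral decomposition and positivity of the trace pairing *)

(** The eigenvalues are written as values of the form of [M] at the eigenvectors, so any sign or
    vanishing of the form transfers to the coefficients. *)
Lemma spectral_sum (R : realType) (n : nat) (M : 'M[R[i]]_n) :
  M *m adjoint M = adjoint M *m M ->
  exists x : 'I_n -> 'cV[R[i]]_n,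
    M = \sum_i (adjoint (x i) *m M *m x i) 0 0 *: (x i *m adjoint (x i)).
Proof.
rewrite adjointE => /eqP nM.
have {}nM : M \is normalmx by [].
set P := spectralmx M; set d := spectral_diag M.
have uP : P *m adjoint P = 1%:M.
  by rewrite adjointE; apply/unitarymxP/spectral_unitarymx.
have uP' : adjoint P *m P = 1%:M by apply: mulmx1C.
have eM : M = adjoint P *m diag_mx d *m P.
  rewrite {1}(orthomx_spectralP nM) -/P -/d adjointE invmx_unitary //.
  exact: spectral_unitarymx.
have eD : diag_mx d = P *m M *m adjoint P.
  by rewrite eM !mulmxA uP mul1mx -mulmxA uP mulmx1.
(* [P] diagonalizes [M] as [adjoint P *m diag_mx d *m P], so the columns of [adjoint P] are
   orthonormal eigenvectors. *)
exists (fun i => col i (adjoint P)).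
have ar i : adjoint (col i (adjoint P)) = row i P.
  by rewrite -[RHS]adjointK; congr adjoint; apply/matrixP => a b; rewrite !mxE.
have -> : \sum_i (adjoint (col i (adjoint P)) *m M *m col i (adjoint P)) 0 0 *:
    (col i (adjoint P) *m adjoint (col i (adjoint P))) =
    \sum_i d 0 i *: (col i (adjoint P) *m row i P).
  apply: eq_bigr => i _; rewrite ar; congr (_ *: _).
  have -> : (row i P *m M *m col i (adjoint P)) 0 0 = (P *m M *m adjoint P) i i.
    rewrite [LHS]mxE [RHS]mxE; apply: eq_bigr => k _; congr (_ * _); last by rewrite mxE.
    by rewrite [LHS]mxE [RHS]mxE; apply: eq_bigr => l _; rewrite [row _ _ _ _]mxE.
  by rewrite -eD mxE eqxx mulr1n.
rewrite eM; apply/matrixP => a b; rewrite mul_mx_diag summxE mxE.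
apply: eq_bigr => i _; rewrite !mxE big_ord1 !mxE.
by rewrite mulrA [d 0 i * _]mulrC.
Qed.

(** The form of [M] is real, so the form of the anti-Hermitian [D = M - adjoint M] vanishes; [D] is
    normal, hence zero by [spectral_sum]. *)
Lemma psd_op_self_adjoint (R : realType) (n : nat) (M : 'M[R[i]]_n) :
  psd_op M -> adjoint M = M.
Proof.
move=> pM; pose D := M - adjoint M.
have aD : adjoint D = - D.
  by rewrite /D adjointD adjointN adjointK opprB addrC.
have D0 (x : 'cV_n) : (adjoint x *m D *m x) 0 0 = 0.
  rewrite /D mulmxBr mulmxBl mxE [X in _ + X]mxE.
  have -> : adjoint x *m adjoint M *m x = adjoint (adjoint x *m M *m x).
    by rewrite !adjointM adjointK mulmxA.
  rewrite [adjoint _ _ _]mxE; move: (pM x); rewrite lecE => /andP[/eqP /= Im0 _].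
  by move: Im0; case: (_ 0 0) => a b /= ->; rewrite /cconj /= oppr0 subrr.
have [|x Dx] := @spectral_sum R n D; first by rewrite aD mulmxN mulNmx.
suff : D = 0 by move/subr0_eq.
by rewrite Dx big1 // => i _; rewrite D0 scale0r.
Qed.

(** Decomposing [M] spectrally turns the trace into a sum of eigenvalues of [M] times values of the
    form of [A]. *)
Lemma rtr_ge0 (R : realType) (n : nat) (A M : 'M[R[i]]_n) :
  accretive A -> psd_op M -> 0 <= rtr A M.
Proof.
move=> aA pM; have [|x Mx] := @spectral_sum R n M.
  by rewrite psd_op_self_adjoint.
rewrite /rtr {1}Mx mulmx_sumr (raddf_sum (@mxtrace _ n)) (raddf_sum (@complex.Re R)).
apply: sumr_ge0 => i _ /=.
rewrite -scalemxAr linearZ /= -quad_form_tr.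
move: (pM (x i)); rewrite lecE => /andP[/eqP /= Im0 Re0].
have -> : (adjoint (x i) *m M *m x i) 0 0 = (qf (x i) M)%:C.
  by apply/eqP; rewrite eq_complex /= Im0 !eqxx.
rewrite ReZ; apply: mulr_ge0 => //; exact: aA.
Qed.

(** * Positive first-order steps of the Lindblad equation *)

(* Non-Hermitian effective Hamiltonian: [lindblad M = damp M + M damp^* + jump M]. *)
Definition damp (R : realType) (n K : nat) (H : 'M[R[i]]_n)
    (L : 'I_K -> 'M[R[i]]_n) : 'M[R[i]]_n :=
  - 'i *: H - \sum_k chalf R *: (adjoint (L k) *m L k).

Definition jump (R : realType) (n K : nat) (L : 'I_K -> 'M[R[i]]_n)
    (M : 'M[R[i]]_n) : 'M[R[i]]_n :=
  \sum_k L k *m M *m adjoint (L k).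

Lemma conj_chalf (R : realType) : (chalf R)^* = chalf R.
Proof. by rewrite /chalf conjc_inv conjc_nat. Qed.

Lemma adjoint_damp (R : realType) (n K : nat) (H : 'M[R[i]]_n)
    (L : 'I_K -> 'M[R[i]]_n) : H = adjoint H ->
  adjoint (damp H L) = 'i *: H - \sum_k chalf R *: (adjoint (L k) *m L k).
Proof.
move=> eH; rewrite /damp adjointD adjointN adjoint_sum; congr (_ - _).
  by rewrite scaleNr adjointN adjointZ -eH -scaleNr; congr (_ *: _);
    apply/eqP; rewrite eq_complex /= !oppr0 opprK !eqxx.
by apply: eq_bigr => k _; rewrite adjointZ adjointM adjointK conj_chalf.
Qed.

Lemma lindbladE (R : realType) (n K : nat) (H : 'M[R[i]]_n)
    (L : 'I_K -> 'M[R[i]]_n) (M : 'M[R[i]]_n) : H = adjoint H ->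
  lindblad H L M = damp H L *m M + M *m adjoint (damp H L) + jump L M.
Proof.
move=> eH; rewrite adjoint_damp // /damp /lindblad /jump.
rewrite mulmxBl mulmxBr !sumrB mulmx_suml mulmx_sumr.
under [\sum_i _ *m M]eq_bigr => k _ do rewrite -scalemxAl.
under [\sum_i M *m _]eq_bigr => k _ do rewrite -scalemxAr.
rewrite -scalemxAl -scalemxAr scalerBr !scaleNr opprK.
rewrite [X in _ = X + _]addrACA -[RHS]addrA; congr (_ + _).
by rewrite -addrA [RHS]addrC.
Qed.

(* The left-hand side is manifestly positive in [M]. *)
Lemma kraus_step (R : realType) (n K : nat) (H : 'M[R[i]]_n)
    (L : 'I_K -> 'M[R[i]]_n) (M : 'M[R[i]]_n) (h : R) : H = adjoint H ->
  let A := damp H L in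
  (1%:M + h%:C *: A) *m M *m adjoint (1%:M + h%:C *: A) + h%:C *: jump L M =
  M + h%:C *: lindblad H L M + (h ^+ 2)%:C *: (A *m M *m adjoint A).
Proof.
move=> eH /=; rewrite lindbladE //; move: (damp H L) => A.
rewrite adjointD adjoint1 adjointZ conjc_real.
have -> : (h ^+ 2)%:C = h%:C * h%:C by rewrite expr2 rmorphM.
rewrite !mulmxDl !mulmxDr !mul1mx !mulmx1 !scalerDr -!scalemxAl -!scalemxAr.
rewrite -scalerA -!addrA; congr (_ + _).
by rewrite addrCA; congr (_ + _); congr (_ + _); rewrite addrC.
Qed.

(** Each conjugation [B *m M *m adjoint B] has at [x] the form of [M] at [adjoint B *m x]. *)
Lemma accretive_kraus (R : realType) (n K : nat) (B : 'M[R[i]]_n)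
    (L : 'I_K -> 'M[R[i]]_n) (M : 'M[R[i]]_n) (h : R) : 0 <= h -> accretive M ->
  accretive (B *m M *m adjoint B + h%:C *: jump L M).
Proof.
move=> h0 aM x; rewrite qfD qf_conj qfZ addr_ge0 ?mulr_ge0 //.
rewrite /jump qf_rtr rtr_suml sumr_ge0 // => k _.
by rewrite -qf_rtr qf_conj.
Qed.

(** * Linearity, and duality with the Heisenberg generator *)

Lemma lindbladD (R : realType) (n K : nat) (H : 'M[R[i]]_n)
    (L : 'I_K -> 'M[R[i]]_n) (M N : 'M[R[i]]_n) : H = adjoint H ->
  lindblad H L (M + N) = lindblad H L M + lindblad H L N.
Proof.
move=> eH; rewrite !lindbladE //; move: (damp H L) => A.
have -> : jump L (M + N) = jump L M + jump L N.
  by rewrite /jump -big_split; apply: eq_bigr => k _; rewrite mulmxDr mulmxDl.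
by rewrite mulmxDr mulmxDl [X in X + _]addrACA [LHS]addrACA.
Qed.

Lemma lindbladZ (R : realType) (n K : nat) (H : 'M[R[i]]_n)
    (L : 'I_K -> 'M[R[i]]_n) (z : R[i]) (M : 'M[R[i]]_n) : H = adjoint H ->
  lindblad H L (z *: M) = z *: lindblad H L M.
Proof.
move=> eH; rewrite !lindbladE //; move: (damp H L) => A.
rewrite -scalemxAr -scalemxAl !scalerDr; congr (_ + _).
rewrite /jump scaler_sumr; apply: eq_bigr => k _.
by rewrite -scalemxAr -scalemxAl.
Qed.

(** Cyclicity of the trace moves the coupling operators onto [Y]; the Hamiltonian part cancels
    because [Y] commutes with [H]. *)
Lemma tr_lindblad (R : realType) (n K : nat) (H : 'M[R[i]]_n)
    (L : 'I_K -> 'M[R[i]]_n) (Y M : 'M[R[i]]_n) : H *m Y = Y *m H ->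
  \tr (Y *m lindblad H L M) = \tr (lgen L Y *m M).
Proof.
move=> HY; rewrite /lindblad /lgen mulmxDr linearD /=.
rewrite -scalemxAr linearZ /= mulmxBr linearB /= !mulmxA -HY.
rewrite [\tr (Y *m M *m H)]mxtrace_mulC mulmxA subrr mulr0 add0r.
rewrite mulmx_sumr mulmx_suml !(raddf_sum (@mxtrace _ n)).
apply: eq_bigr => k _; rewrite !mulmxBr !mulmxBl !(raddfB (@mxtrace _ n)).
rewrite /= -!scalemxAr -!scalemxAl !mxtraceZ [RHS]addrAC.
have cyc (B C D : 'M[R[i]]_n) : \tr (B *m (C *m D)) = \tr (D *m B *m C).
  by rewrite mulmxA mxtrace_mulC mulmxA.
have e1 : \tr (Y *m (L k *m M *m adjoint (L k))) =
    \tr (adjoint (L k) *m Y *m L k *m M) by rewrite cyc mulmxA.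
have e2 : \tr (Y *m (adjoint (L k) *m L k *m M)) =
    \tr (Y *m (adjoint (L k) *m L k) *m M) by rewrite mulmxA.
by rewrite e1 e2 [\tr (Y *m (M *m _))]cyc.
Qed.

Lemma lgenD (R : realType) (n K : nat) (L : 'I_K -> 'M[R[i]]_n)
    (X Y : 'M[R[i]]_n) : lgen L (X + Y) = lgen L X + lgen L Y.
Proof.
rewrite /lgen -big_split; apply: eq_bigr => k _ /=.
rewrite !mulmxDr !mulmxDl !scalerDr !opprD.
by rewrite [X in X + _]addrACA [LHS]addrACA.
Qed.

Lemma lgenZ (R : realType) (n K : nat) (L : 'I_K -> 'M[R[i]]_n) (z : R[i])
    (X : 'M[R[i]]_n) : lgen L (z *: X) = z *: lgen L X.
Proof.
rewrite /lgen scaler_sumr; apply: eq_bigr => k _ /=.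
by rewrite -!scalemxAr -!scalemxAl !scalerBr !scalerA ![chalf R * z]mulrC.
Qed.

Lemma lgen1 (R : realType) (n K : nat) (L : 'I_K -> 'M[R[i]]_n) :
  lgen L 1%:M = 0.
Proof.
rewrite /lgen big1 // => k _; rewrite !mulmx1 mul1mx -addrA -opprD -scalerDl.
have -> : chalf R + chalf R = 1 by rewrite /chalf -mulr2n -[_ *+ 2]mulr_natl mulfV ?pnatr_eq0.
by rewrite scale1r subrr.
Qed.

(** * An entrywise norm that dominates quadratic forms *)

Definition l1norm (R : realType) (n : nat) (E : 'M[R[i]]_n) : R :=
  \sum_i \sum_j (`|complex.Re (E i j)| + `|complex.Im (E i j)|).

Lemma l1norm_ge0 (R : realType) (n : nat) (E : 'M[R[i]]_n) : 0 <= l1norm E.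
Proof. by do 2 (apply: sumr_ge0 => ? _); rewrite addr_ge0. Qed.

Lemma qf1E (R : realType) (n : nat) (x : 'cV[R[i]]_n) :
  qf x 1%:M = \sum_i (complex.Re (x i 0) ^+ 2 + complex.Im (x i 0) ^+ 2).
Proof.
rewrite /qf mulmx1 mxE (raddf_sum (@complex.Re R)); apply: eq_bigr => i _.
by rewrite !mxE; case: (x i 0) => a b /=; ring.
Qed.

Lemma qf1_ge0 (R : realType) (n : nat) (x : 'cV[R[i]]_n) : 0 <= qf x 1%:M.
Proof. by rewrite qf1E sumr_ge0 // => i _; rewrite addr_ge0 ?sqr_ge0. Qed.

Lemma qf1_ge (R : realType) (n : nat) (x : 'cV[R[i]]_n) (i : 'I_n) :
  complex.Re (x i 0) ^+ 2 + complex.Im (x i 0) ^+ 2 <= qf x 1%:M.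
Proof.
rewrite qf1E (bigD1 i) //= lerDl sumr_ge0 // => j _.
by rewrite addr_ge0 ?sqr_ge0.
Qed.

(** By the arithmetic-geometric mean inequality, both [a * c + b * d] and [b * c - a * d] are at
    most [s] in absolute value. *)
Lemma Re_triple_le (R : realType) (z e w : R[i]) (s : R) :
  complex.Re z ^+ 2 + complex.Im z ^+ 2 <= s ->
  complex.Re w ^+ 2 + complex.Im w ^+ 2 <= s ->
  `|complex.Re (cconj z * e * w)| <= (`|complex.Re e| + `|complex.Im e|) * s.
Proof.
case: z e w => a b [u v] [c d] /= hz hw.
have -> : (a * u - - b * v) * c - (a * v + - b * u) * d =
  u * (a * c + b * d) + v * (b * c - a * d) by ring.
rewrite mulrDl (le_trans (ler_normD _ _)) // !normrM lerD // ler_wpM2l //.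
  have := (sqr_ge0 (a - c), sqr_ge0 (b - d), sqr_ge0 (a + c), sqr_ge0 (b + d)).
  by rewrite ler_norml => -[[[? ?] ?] ?]; apply/andP; split; nra.
have := (sqr_ge0 (b - c), sqr_ge0 (a + d), sqr_ge0 (b + c), sqr_ge0 (a - d)).
by rewrite ler_norml => -[[[? ?] ?] ?]; apply/andP; split; nra.
Qed.

Lemma qf_norm_le (R : realType) (n : nat) (x : 'cV[R[i]]_n) (E : 'M[R[i]]_n) :
  `|qf x E| <= l1norm E * qf x 1%:M.
Proof.
have -> : qf x E = \sum_i \sum_j complex.Re (cconj (x i 0) * E i j * x j 0).
  rewrite /qf mxE (raddf_sum (@complex.Re R)) exchange_big.
  apply: eq_bigr => j _; rewrite mxE mulr_suml (raddf_sum (@complex.Re R)).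
  by apply: eq_bigr => i _; rewrite mxE.
rewrite /l1norm mulr_suml (le_trans (ler_norm_sum _ _ _)) // ler_sum // => i _.
rewrite mulr_suml (le_trans (ler_norm_sum _ _ _)) // ler_sum // => j _.
by apply: Re_triple_le; exact: qf1_ge.
Qed.

Lemma qf_le (R : realType) (n : nat) (x : 'cV[R[i]]_n) (E : 'M[R[i]]_n) :
  qf x E <= l1norm E * qf x 1%:M.
Proof. exact: le_trans (ler_norm _) (qf_norm_le x E). Qed.

Local Open Scope classical_set_scope.

(** * Real analysis: continuous induction and one-sided expansions *)

(** Consider the infimum of the counterexamples: [P] holds there by the base case or the left step,
    and the right step clears an interval beyond it, against the infimum being approached. *)
Lemma real_induction (R : realType) (P : R -> Prop) :
  P 0 ->
  (forall t, 0 < t -> (forall s, 0 <= s < t -> P s) -> P t) ->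
  (forall t, 0 <= t -> P t -> exists2 d, 0 < d &
     forall s, t < s < t + d -> P s) ->
  forall t, 0 <= t -> P t.
Proof.
move=> P0 Pleft Pright t t0; apply: contrapT => nPt.
pose F := [set s | 0 <= s /\ ~ P s].
have hF : has_inf F by split; [exists t|exists 0 => s []].
have i0 : 0 <= inf F by apply: lb_le_inf => [|s []//]; exists t.
have Plt s : 0 <= s < inf F -> P s.
  move=> /andP[s0 si]; apply: contrapT => nPs.
  have : inf F <= s by apply: ge_inf => //; exact: hF.2.
  by rewrite leNgt si.
have Pi : P (inf F).
  by move: i0; rewrite le_eqVlt => /orP[/eqP <-//|i0]; exact: Pleft.
have [d d0 Pd] := Pright _ i0 Pi.
have [s [s0 nPs] sd] := inf_adherent d0 hF.
have is_ : inf F <= s by apply: ge_inf => //; exact: hF.2.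
apply: nPs; move: is_; rewrite le_eqVlt => /orP[/eqP <-//|is_].
by apply: Pd; rewrite is_.
Qed.

Lemma is_derive_expansion (R : realType) (f : R -> R) (t l e : R) :
  is_derive t 1 f l -> 0 < e ->
  \forall h \near 0^'+, `|f (t + h) - f t - h * l| <= e * h.
Proof.
move=> [df dfl] e0.
have : h^-1 *: (f (h *: 1 + t) - f t) @[h --> 0^'+] --> l.
  by apply: cvg_dnbhs_at_right; rewrite -dfl; exact: df.
move=> /cvgrPdist_le /(_ e e0) H; near=> h.
have h0 : 0 < h by near: h; exact: nbhs_right_gt.
have : `|l - h^-1 *: (f (h *: 1 + t) - f t)| <= e by near: h.
rewrite -(ler_pM2r h0); apply: le_trans.
rewrite -[X in _ <= _ * X](gtr0_norm h0) -normrM distrC le_eqVlt.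
apply/orP/or_introl/eqP; congr (`|_|); rewrite /GRing.scale /= mulr1 (addrC h t).
by field; rewrite gt_eqF.
Unshelve. all: by end_near. Qed.

Lemma is_derive_ge (R : realType) (g dg : R -> R) (k : R) :
  (forall t : R, is_derive t 1 g (dg t)) -> (forall t, 0 <= t -> k <= dg t) ->
  forall s t, 0 <= s -> s <= t -> g s + k * (t - s) <= g t.
Proof.
move=> Dg kdg s t s0 st.
have cg : {within `[s, t], continuous g}.
  by apply: derivable_within_continuous => x _; case: (Dg x).
have [c] := MVT_segment st (fun x _ => Dg x) cg.
rewrite in_itv /= => /andP[sc _] e.
have := kdg c (le_trans s0 sc); have ts : 0 <= t - s by rewrite subr_ge0.
by move=> /(ler_wpM2r ts); rewrite -e; lra.
Qed.

(** * Derivatives and limits of observables *)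

(** As a real-linear combination of the real and imaginary parts of the entries, the pairing
    inherits entrywise derivatives and limits. *)
Lemma rtrE (R : realType) (n : nat) (Y M : 'M[R[i]]_n) :
  rtr Y M = \sum_i \sum_j (complex.Re (Y i j) * complex.Re (M j i) -
                           complex.Im (Y i j) * complex.Im (M j i)).
Proof.
rewrite /rtr (raddf_sum (@complex.Re R)); apply: eq_bigr => i _.
rewrite mxE (raddf_sum (@complex.Re R)); apply: eq_bigr => j _.
by case: (Y i j) => a b; case: (M j i).
Qed.

Lemma is_derive_rtr (R : realType) (n : nat) (Y : 'M[R[i]]_n)
    (rho : R -> 'M[R[i]]_n) (t : R) (D : 'M[R[i]]_n) :
  (forall i j,
    is_derive t 1 (fun s => complex.Re (rho s i j)) (complex.Re (D i j)) /\
    is_derive t 1 (fun s => complex.Im (rho s i j)) (complex.Im (D i j))) ->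
  is_derive t 1 (fun s => rtr Y (rho s)) (rtr Y D).
Proof.
move=> HD.
have -> : (fun s => rtr Y (rho s)) = \sum_i \sum_j
    (complex.Re (Y i j) *: (fun s => complex.Re (rho s j i)) -
     complex.Im (Y i j) *: (fun s => complex.Im (rho s j i))).
  apply/funext => s; rewrite rtrE fct_sumE; apply: eq_bigr => i _.
  by rewrite fct_sumE.
rewrite rtrE; apply: is_derive_sum => i; apply: is_derive_sum => j.
by apply: is_deriveB; apply: is_deriveZ; case: (HD j i).
Qed.

Lemma cvg_rtr (R : realType) (n : nat) (Y sigma : 'M[R[i]]_n)
    (M : nat -> 'M[R[i]]_n) :
  (forall i j,
    ((fun k => complex.Re (M k i j)) @ \oo --> complex.Re (sigma i j)) /\
    ((fun k => complex.Im (M k i j)) @ \oo --> complex.Im (sigma i j))) ->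
  (fun k => rtr Y (M k)) @ \oo --> rtr Y sigma.
Proof.
move=> HM; rewrite rtrE; under eq_fun => k do rewrite rtrE.
apply: cvg_big => [|i _]; first exact: add_continuous.
apply: cvg_big => [|j _]; first exact: add_continuous.
by apply: cvgB; (apply: cvgM; first exact: cvg_cst); case: (HM j i).
Qed.

Lemma near0_right_ex (R : realType) (P : R -> Prop) :
  (\forall h \near 0^'+, P h) ->
  exists2 r, 0 < r & forall h, 0 < h < r -> P h.
Proof.
rewrite /at_right near_withinE => -[r /= r0 Hr]; exists r => // h /andP[h0 hr].
by apply: Hr => //=; rewrite sub0r normrN gtr0_norm.
Qed.

(** * Preservation of positivity by the flow *)

Lemma qf_increment_ge (R : realType) (n : nat) (x : 'cV[R[i]]_n)
    (M N G : 'M[R[i]]_n) (h : R) :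
  - (l1norm (N - M - h%:C *: G) * qf x 1%:M) <= qf x N - qf x M - h * qf x G.
Proof.
have := qf_norm_le x (N - M - h%:C *: G).
by rewrite qfD qfN qfZ qfD qfN ler_norml => /andP[].
Qed.

(** Arithmetic of one step with slack [D]. The derivative error and the second-order term of the
    state each cost at most [D / 2 * h * N], paid by the 1 in [l1 + l2 + 1]; the terms from [D]
    times the identity cost [l1 + l2], using [h <= 1]. *)
Lemma euler_bound (R : realType)
    (h D N l2 c l1 lE q_th q_t q_l q_l1 q_a q_a1 dt : R) :
  0 <= h -> h <= 1 -> 0 <= D -> 0 <= N -> 0 <= l2 -> h * c <= D / 2 ->
  lE <= D / 2 * h -> - (lE * N) <= q_th - q_t - h * q_l ->
  q_l1 <= l1 * N -> q_a1 <= l2 * N -> q_a <= c * N ->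
  D * (1 + (l1 + l2 + 1) * h) <= dt ->
  0 <= (q_t + D * N) + h * (q_l + D * q_l1) + h ^+ 2 * (q_a + D * q_a1) ->
  0 <= q_th + dt * N.
Proof.
move=> h0 h1 D0 n0 l20 hc hE hq q1 q2 q3 dth pos.
have {}hE : lE * N <= D / 2 * h * N by rewrite ler_wpM2r.
have {}dth : D * (1 + (l1 + l2 + 1) * h) * N <= dt * N by rewrite ler_wpM2r.
have {}q1 : h * D * q_l1 <= h * D * (l1 * N) by rewrite ler_wpM2l ?mulr_ge0.
have {}q2 : h ^+ 2 * D * q_a1 <= h ^+ 2 * D * (l2 * N).
  by rewrite ler_wpM2l ?mulr_ge0 ?sqr_ge0.
have {}q3 : h ^+ 2 * q_a <= h ^+ 2 * (c * N) by rewrite ler_wpM2l ?sqr_ge0.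
have {}hc : h * c * (h * N) <= D / 2 * (h * N) by rewrite ler_wpM2r ?mulr_ge0.
have {}h1 : h * (h * D * (l2 * N)) <= 1 * (h * D * (l2 * N)).
  by rewrite ler_wpM2r ?mulr_ge0.
move: hE dth q1 q2 q3 hc h1 hq pos; clear; rewrite expr2 => *; lra.
Qed.

Lemma accretive_euler_step (R : realType) (n K : nat) (H : 'M[R[i]]_n)
    (L : 'I_K -> 'M[R[i]]_n) (M : 'M[R[i]]_n) (h d : R) (x : 'cV[R[i]]_n) :
  let A := damp H L in
  H = adjoint H -> 0 <= h -> accretive (M + d%:C *: 1%:M) ->
  0 <= (qf x M + d * qf x 1%:M) +
       h * (qf x (lindblad H L M) + d * qf x (lindblad H L 1%:M)) +
       h ^+ 2 * (qf x (A *m M *m adjoint A) + d * qf x (A *m 1%:M *m adjoint A)).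
Proof.
move=> A eH h0 aM.
have := accretive_kraus (1%:M + h%:C *: A) L h0 aM x.
rewrite kraus_step // -/A (lindbladD L M _ eH) (lindbladZ L _ _ eH).
move: (lindblad H L M) (lindblad H L 1%:M) => G G1; clearbody A.
have -> : A *m (M + d%:C *: 1%:M) *m adjoint A =
    A *m M *m adjoint A + d%:C *: (A *m 1%:M *m adjoint A).
  by rewrite (mulmxDr A) mulmxDl -(scalemxAr d%:C A) -scalemxAl.
by rewrite !qfD !qfZ !qfD !qfZ.
Qed.

Lemma lindblad_expansion (R : realType) (n K : nat) (H : 'M[R[i]]_n)
    (L : 'I_K -> 'M[R[i]]_n) (rho : R -> 'M[R[i]]_n) (t e : R) :
  solves_lindblad H L rho -> 0 < e ->
  \forall h \near 0^'+,
    l1norm (rho (t + h) - rho t - h%:C *: lindblad H L (rho t)) <= e * h.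
Proof.
move=> sol e0; pose N : R := (n * n * 2)%:R.
have N0 : 0 <= N by rewrite ler0n.
(* [N] counts the real coordinates, so the coordinate errors add up to [N * e' * h]; the added 1
   keeps the denominator positive when [n] is 0. *)
pose e' := e / (N + 1); have e'0 : 0 < e' by rewrite divr_gt0 //; lra.
have bnd : \forall h \near 0^'+, forall i j,
    `|complex.Re (rho (t + h) i j) - complex.Re (rho t i j) -
      h * complex.Re (lindblad H L (rho t) i j)| <= e' * h /\
    `|complex.Im (rho (t + h) i j) - complex.Im (rho t i j) -
      h * complex.Im (lindblad H L (rho t) i j)| <= e' * h.
  apply: filter_forall => i; apply: filter_forall => j; apply: filterI.
    exact: (is_derive_expansion (sol t i j).1).
  exact: (is_derive_expansion (sol t i j).2).
apply: filterS2 bnd (nbhs_right_gt 0) => h.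
move: (lindblad H L (rho t)) => D Bh h0.
apply: (@le_trans _ _ (\sum_(i < n) \sum_(j < n) (e' * h + e' * h))).
  apply: ler_sum => i _; apply: ler_sum => j _; rewrite !mxE.
  have [] := Bh i j; move: (rho _ i j) (rho _ i j) (D i j).
  by move=> [a b] [c d] [u v] /= ? ?; rewrite !mul0r subr0 addr0 lerD.
rewrite !sumr_const !card_ord -!mulrnA -mulr2n -mulrnA -mulr_natr.
rewrite mulnC -/N mulrAC ler_pM2r // /e' mulrAC ler_pdivrMr ?ltr_wpDl //.
by rewrite ler_pM2l //; lra.
Qed.

Lemma is_derive_continuous (R : realType) (f : R -> R) (t l : R) :
  is_derive t 1 f l -> {for t, continuous f}.
Proof. by move=> [df _]; apply/differentiable_continuous/derivable1_diffP. Qed.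

Lemma is_derive_qf (R : realType) (n K : nat) (H : 'M[R[i]]_n)
    (L : 'I_K -> 'M[R[i]]_n) (rho : R -> 'M[R[i]]_n) (x : 'cV[R[i]]_n) (t : R) :
  solves_lindblad H L rho ->
  is_derive t 1 (fun s => qf x (rho s)) (qf x (lindblad H L (rho t))).
Proof.
move=> sol; rewrite qf_rtr rtrC; under eq_fun => s do rewrite qf_rtr rtrC.
exact: is_derive_rtr.
Qed.

(** Continuous induction on the state plus a slack: limits give the left step, and a positive Euler
    step, whose errors the growing slack absorbs, gives the right step. *)
Lemma accretive_lindblad (R : realType) (n K : nat) (H : 'M[R[i]]_n)
    (L : 'I_K -> 'M[R[i]]_n) (rho : R -> 'M[R[i]]_n) :
  H = adjoint H -> solves_lindblad H L rho -> accretive (rho 0) ->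
  forall t : R, 0 <= t -> accretive (rho t).
Proof.
move=> eH sol acc0; pose A := damp H L.
(* [C] bounds the growth rate of [1] under one positive step of length at most 1. *)
pose C := l1norm (lindblad H L 1%:M) + l1norm (A *m 1%:M *m adjoint A).
have C0 : 0 <= C by rewrite addr_ge0 ?l1norm_ge0.
(* The rate exceeds [C] by 1 to pay for the derivative error and the second-order term in
   [rho t]. *)
pose d (e t : R) : R := e * expR ((C + 1) * t).
have d0 (e t : R) : 0 < e -> 0 < d e t by move=> e0; rewrite mulr_gt0 ?expR_gt0.
have main (e : R) : 0 < e -> forall t : R, 0 <= t -> accretive (rho t + (d e t)%:C *: 1%:M).
  move=> e0; apply: real_induction => [x|t t0 accs x|t t0 acct].
  - rewrite qfD qfZ addr_ge0 ?mulr_ge0 ?qf1_ge0 //.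
    exact: ltW.
  - rewrite qfD qfZ.
    (* Continuity in time carries nonnegativity from the left of [t] to [t]. *)
    have : (fun s => qf x (rho s) + d e s * qf x 1%:M) s @[s --> t^'-] -->
        qf x (rho t) + d e t * qf x 1%:M.
      apply: cvg_at_left_filter; apply: cvgD.
        exact: (is_derive_continuous (is_derive_qf x t sol)).
      apply: cvgM; last exact: cvg_cst.
      apply: cvgM; first exact: cvg_cst.
      apply: (@cvg_comp _ _ _ (fun s => (C + 1) * s) expR); last exact: continuous_expR.
      by apply: cvgM; [exact: cvg_cst|exact: cvg_id].
    move=> /cvgr_to_ge; apply; near=> s.
    rewrite -qfZ -qfD; apply: accs; apply/andP; split; last first.
      by near: s; exact: nbhs_left_lt.
    by near: s; exact: nbhs_left_ge.
  pose D := d e t; have D0 : 0 < D := d0 _ _ e0.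
  (* Bounds the second-order term of the state uniformly in [x], so that one range of [h] serves
     every vector. *)
  pose c := l1norm (A *m rho t *m adjoint A).
  have c0 : 0 <= c by exact: l1norm_ge0.
  have : \forall h \near 0^'+, accretive (rho (t + h) + (d e (t + h))%:C *: 1%:M).
    near=> h; have h0 : 0 < h by near: h; exact: nbhs_right_gt.
    have h1 : h <= 1 by near: h; exact: nbhs_right_le.
    have hc : h * c <= D / 2.
      have : h <= D / 2 / (c + 1).
        by near: h; apply: nbhs_right_le; rewrite !divr_gt0 //; lra.
      rewrite ler_pdivlMr; last lra.
      by lra.
    have hE : l1norm (rho (t + h) - rho t - h%:C *: lindblad H L (rho t))
        <= D / 2 * h.
      by near: h; apply: lindblad_expansion; rewrite // divr_gt0.
    move=> x.
    have := accretive_euler_step L x eH (ltW h0) acct; rewrite -/A -/D.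
    have hq := qf_increment_ge x (rho t) (rho (t + h)) (lindblad H L (rho t)) h.
    have n0 := qf1_ge0 x.
    have q1 := qf_le x (lindblad H L 1%:M).
    have q2 := qf_le x (A *m 1%:M *m adjoint A).
    have q3 := qf_le x (A *m rho t *m adjoint A).
    have dth : D * (1 + (C + 1) * h) <= d e (t + h).
      rewrite /D /d [(C + 1) * (t + h)]mulrDr expRD mulrA ler_pM2l ?mulr_gt0 ?expR_gt0 //.
      exact: expR_ge1Dx.
    have c20 := l1norm_ge0 (A *m 1%:M *m adjoint A).
    move=> pos; rewrite qfD qfZ.
    exact: (euler_bound (ltW h0) h1 (ltW D0) n0 c20 hc hE hq q1 q2 q3 dth pos).
  move=> /near0_right_ex[r r0 Hr]; exists r; first exact: r0.
  move=> s /andP[ts str].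
  have -> : s = t + (s - t) by rewrite addrC subrK.
  by apply: Hr; rewrite subr_gt0 ts ltrBlDl.
move=> t t0 x; rewrite -oppr_le0; apply/ler_addgt0Pr => e e0; rewrite add0r.
(* With parameter [e / k] the slack in the form at [x] is below [e]; the added 1 keeps [k] positive
   when [x] is zero. *)
pose k := expR ((C + 1) * t) * qf x 1%:M + 1.
have k0 : 0 < k by rewrite ltr_wpDl // mulr_ge0 ?qf1_ge0 // ltW ?expR_gt0.
have := main (e / k) (divr_gt0 e0 k0) t t0 x; rewrite qfD qfZ /d.
have : e / k * k = e by rewrite divfK // gt_eqF.
have : 0 < e / k by rewrite divr_gt0.
by rewrite /k; lra.
Unshelve. all: by end_near. Qed.

Lemma solves_lindblad_i (R : realType) (n K : nat) (H : 'M[R[i]]_n)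
    (L : 'I_K -> 'M[R[i]]_n) (rho : R -> 'M[R[i]]_n) :
  H = adjoint H -> solves_lindblad H L rho ->
  solves_lindblad H L (fun t => 'i *: rho t).
Proof.
move=> eH sol t i j; have [DRe DIm] := sol t i j.
have iE (z : R[i]) : 'i * z = Complex (- complex.Im z) (complex.Re z).
  by case: z => a b; apply/eqP; rewrite eq_complex /= !mul0r !mul1r sub0r add0r !eqxx.
rewrite lindbladZ //; move: (lindblad H L (rho t)) DRe DIm => D DRe DIm.
rewrite mxE iE; split => /=.
  under eq_fun => s do rewrite mxE iE /=.
  exact: is_deriveN.
by under eq_fun => s do rewrite mxE iE /=.
Qed.

(* [lindblad] is complex linear, so real-part positivity of the flow applies to
   [i rho] and [- i rho] too and keeps the quadratic form of [rho] real. *)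
Lemma psd_lindblad (R : realType) (n K : nat) (H : 'M[R[i]]_n)
    (L : 'I_K -> 'M[R[i]]_n) (rho : R -> 'M[R[i]]_n) :
  H = adjoint H -> solves_lindblad H L rho -> psd_op (rho 0) ->
  forall t : R, 0 <= t -> psd_op (rho t).
Proof.
move=> eH sol /psd_opP[a0 ai0 aNi0] t t0.
have iii (M : 'M[R[i]]_n) : 'i *: ('i *: ('i *: M)) = - ('i *: M).
  by rewrite scalerA -expr2 sqr_i scaleN1r.
have sol1 := solves_lindblad_i eH sol.
have sol3 := solves_lindblad_i eH (solves_lindblad_i eH sol1).
apply/psd_opP; split.
- exact: (accretive_lindblad eH sol).
- exact: (accretive_lindblad eH sol1).
- by rewrite -iii; apply: (accretive_lindblad eH sol3 _ t0); rewrite iii.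
Qed.

(** * Evolution of observables and conservation of the trace *)

Lemma is_derive_observable (R : realType) (n K : nat) (H : 'M[R[i]]_n)
    (L : 'I_K -> 'M[R[i]]_n) (rho : R -> 'M[R[i]]_n) (Y : 'M[R[i]]_n) (t : R) :
  solves_lindblad H L rho -> H *m Y = Y *m H ->
  is_derive t 1 (fun s => rtr Y (rho s)) (rtr (lgen L Y) (rho t)).
Proof.
move=> sol HY; rewrite {2}/rtr -(tr_lindblad L _ HY).
exact: is_derive_rtr (sol t).
Qed.

Lemma observable_ge (R : realType) (n K : nat) (H : 'M[R[i]]_n)
    (L : 'I_K -> 'M[R[i]]_n) (rho : R -> 'M[R[i]]_n) (Y : 'M[R[i]]_n) (k : R) :
  solves_lindblad H L rho -> H *m Y = Y *m H ->
  (forall t : R, 0 <= t -> k <= rtr (lgen L Y) (rho t)) ->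
  forall s t : R, 0 <= s -> s <= t ->
    rtr Y (rho s) + k * (t - s) <= rtr Y (rho t).
Proof.
move=> sol HY kG.
apply: (is_derive_ge (g := fun s => rtr Y (rho s))
  (dg := fun t => rtr (lgen L Y) (rho t))) kG => t.
exact: (is_derive_observable t sol HY).
Qed.

Lemma rtr_conserved (R : realType) (n K : nat) (H : 'M[R[i]]_n)
    (L : 'I_K -> 'M[R[i]]_n) (rho : R -> 'M[R[i]]_n) (Y : 'M[R[i]]_n) :
  solves_lindblad H L rho -> H *m Y = Y *m H -> lgen L Y = 0 ->
  forall t : R, 0 <= t -> rtr Y (rho t) = rtr Y (rho 0).
Proof.
move=> sol HY GY t t0.
have D0 (s : R) : is_derive s 1 (fun s => rtr Y (rho s)) 0.
  have := is_derive_observable s sol HY.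
  by rewrite GY {2}/rtr mul0mx mxtrace0.
exact: (@is_derive_0_is_cst _ (fun s => rtr Y (rho s)) t 0 D0).
Qed.

Lemma rtr_i (R : realType) (n : nat) (Y M : 'M[R[i]]_n) :
  rtr ('i *: Y) M = - complex.Im (\tr (Y *m M)).
Proof. by rewrite /rtr -scalemxAl mxtraceZ mulrC ReiNIm. Qed.

Lemma tr_rtr (R : realType) (n : nat) (Y M : 'M[R[i]]_n) :
  \tr (Y *m M) = Complex (rtr Y M) (- rtr ('i *: Y) M).
Proof. by apply/eqP; rewrite eq_complex rtr_i /= opprK !eqxx. Qed.

(** The real and imaginary parts are the pairings with the identity and ['i] times it, both killed
    by [lgen]. *)
Lemma tr_lindblad_conserved (R : realType) (n K : nat) (H : 'M[R[i]]_n)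
    (L : 'I_K -> 'M[R[i]]_n) (rho : R -> 'M[R[i]]_n) :
  solves_lindblad H L rho ->
  forall t : R, 0 <= t -> \tr (rho t) = \tr (rho 0).
Proof.
move=> sol t t0; rewrite -[rho t]mul1mx -[rho 0]mul1mx !tr_rtr.
rewrite (rtr_conserved sol _ _ t0) ?mulmx1 ?mul1mx ?lgen1 //.
rewrite (rtr_conserved sol _ _ t0) //.
  by rewrite -scalemxAr -scalemxAl mulmx1 mul1mx.
by rewrite lgenZ lgen1 scaler0.
Qed.

Lemma density_lindblad (R : realType) (n K : nat) (H : 'M[R[i]]_n)
    (L : 'I_K -> 'M[R[i]]_n) (rho : R -> 'M[R[i]]_n) :
  H = adjoint H -> solves_lindblad H L rho -> density_state (rho 0) ->
  forall t : R, 0 <= t -> density_state (rho t).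
Proof.
move=> eH sol [p0 tr0] t t0; split; first exact: (psd_lindblad eH sol).
by rewrite (tr_lindblad_conserved sol t0).
Qed.

(** * Limit points of the trajectory *)

Lemma limit_point_ge (R : realType) (n : nat) (rho : R -> 'M[R[i]]_n)
    (sigma Y : 'M[R[i]]_n) (T b : R) :
  traj_limit_point rho sigma ->
  (forall t : R, T <= t -> b <= rtr Y (rho t)) -> b <= rtr Y sigma.
Proof.
move=> [u [uoo urho]] bY.
have /cvgr_to_ge := @cvg_rtr R n Y sigma (rho \o u) urho; apply.
have /cvgryPge /(_ T) := uoo.
by apply: filterS => k; exact: bY.
Qed.

Lemma limit_point_eq (R : realType) (n : nat) (rho : R -> 'M[R[i]]_n)
    (sigma Y : 'M[R[i]]_n) (b : R) :
  traj_limit_point rho sigma ->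
  (forall t : R, 0 <= t -> rtr Y (rho t) = b) -> rtr Y sigma = b.
Proof.
move=> lim bY; apply/eqP; rewrite eq_le; apply/andP; split.
  rewrite -lerN2 -rtrNl; apply: (limit_point_ge (T := 0) lim) => t t0.
  by rewrite rtrNl bY.
by apply: (limit_point_ge (T := 0) lim) => t t0; rewrite bY.
Qed.

(** For each [x] the condition is a closed half-space in the pairing; the scalar [z] covers the
    three cases of [psd_opP]. *)
Lemma accretive_limit_point (R : realType) (n : nat) (rho : R -> 'M[R[i]]_n)
    (sigma : 'M[R[i]]_n) (z : R[i]) :
  traj_limit_point rho sigma -> (forall t : R, 0 <= t -> accretive (z *: rho t)) ->
  accretive (z *: sigma).
Proof.
move=> lim az x.
have qE (M : 'M[R[i]]_n) : qf x (z *: M) = rtr (z *: (x *m adjoint x)) M.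
  by rewrite qf_rtr rtrC /rtr -scalemxAr -scalemxAl.
by rewrite qE; apply: (limit_point_ge (T := 0) lim) => t t0; rewrite -qE az.
Qed.

Lemma density_limit_point (R : realType) (n : nat) (rho : R -> 'M[R[i]]_n)
    (sigma : 'M[R[i]]_n) :
  traj_limit_point rho sigma -> (forall t : R, 0 <= t -> density_state (rho t)) ->
  density_state sigma.
Proof.
move=> lim dens; split.
  have pt t t0 := (psd_opP (rho t)).1 (dens t t0).1.
  apply/psd_opP; split.
  - rewrite -[sigma]scale1r; apply: (accretive_limit_point lim) => t t0.
    by rewrite scale1r; case: (pt t t0).
  - by apply: (accretive_limit_point lim) => t t0; case: (pt t t0).
  - rewrite -scaleNr; apply: (accretive_limit_point lim) => t t0.
    by rewrite scaleNr; case: (pt t t0).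
rewrite -[sigma]mul1mx tr_rtr.
rewrite (limit_point_eq (b := 1) lim) => [|t t0]; last first.
  by rewrite /rtr mul1mx (dens t t0).2.
rewrite (limit_point_eq (b := 0) lim) ?oppr0 // => t t0.
by rewrite rtr_i mul1mx (dens t t0).2 oppr0.
Qed.

(** * Lyapunov estimates along the trajectory *)

Lemma rtr_density_le (R : realType) (n : nat) (X M : 'M[R[i]]_n) :
  density_state M -> rtr X M <= l1norm X.
Proof.
move=> [pM trM].
have : accretive ((l1norm X)%:C *: 1%:M - X).
  by move=> x; rewrite qfD qfZ qfN subr_ge0 qf_le.
move=> /rtr_ge0 /(_ pM); rewrite rtrDl rtrNl rtrZl subr_ge0 => /le_trans; apply.
by rewrite /rtr mul1mx trM mulr1.
Qed.

(** Growth at a positive rate would contradict the uniform bound [rtr_density_le]. Both [X] and [b]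
    stay free so that ES and DS can share the argument. *)
Lemma lyapunov_bound (R : realType) (n K : nat) (H : 'M[R[i]]_n)
    (L : 'I_K -> 'M[R[i]]_n) (rho : R -> 'M[R[i]]_n) (V X : 'M[R[i]]_n)
    (c b l : R) :
  solves_lindblad H L rho -> (forall t : R, 0 <= t -> density_state (rho t)) ->
  H *m X = X *m H -> 0 <= c -> accretive (lgen L X - c%:C *: V + b%:C *: 1%:M) ->
  (forall t : R, 0 <= t -> l <= rtr V (rho t)) -> c * l <= b.
Proof.
move=> sol dens HX c0 aX lV; rewrite leNgt; apply/negP => bcl.
pose k := c * l - b; have k0 : 0 < k by rewrite subr_gt0.
have kG (t : R) : 0 <= t -> k <= rtr (lgen L X) (rho t).
  move=> t0; have [pt trt] := dens t t0.
  have := rtr_ge0 aX pt; rewrite !rtrDl rtrNl !rtrZl.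
  have -> : rtr 1%:M (rho t) = 1 by rewrite /rtr mul1mx trt.
  by have := ler_wpM2l c0 (lV t t0); rewrite /k; lra.
(* By this time growth at rate [k] has pushed the observable at least 1 beyond its bound
   [l1norm X]. *)
pose T := (`|l1norm X - rtr X (rho 0)| + 1) / k.
have T0 : 0 <= T by exact: divr_ge0 (addr_ge0 (normr_ge0 _) ler01) (ltW k0).
have := observable_ge sol HX kG (lexx (0 : R)) T0.
have := rtr_density_le X (dens T T0).
have -> : k * (T - 0) = `|l1norm X - rtr X (rho 0)| + 1.
  by rewrite subr0 mulrC divfK // gt_eqF.
have := ler_norm (l1norm X - rtr X (rho 0)).
move: (l1norm X) (rtr X (rho T)) (rtr X (rho 0)) => p q r.
by clear => *; lra.
Qed.

(* Expand [(s - V / s) W (s - V / s) >= 0]. *)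
Lemma dissipation_bound (R : realType) (n K : nat) (L : 'I_K -> 'M[R[i]]_n)
    (V : 'M[R[i]]_n) (c s : R) :
  let W := - lgen L V in
  0 < s -> V = adjoint V -> accretive W -> accretive (ldiss L V - c%:C *: V) ->
  accretive (lgen L (V *m V - (s ^+ 2)%:C *: V) - c%:C *: V +
       (s ^- 2 * l1norm (V *m W *m V))%:C *: 1%:M).
Proof.
move=> W s0 aV aW aD x.
have -> : lgen L (V *m V - (s ^+ 2)%:C *: V) =
    lgen L (V *m V) + (s ^+ 2)%:C *: W.
  by rewrite -scaleNr lgenD lgenZ scaleNr scalerN.
(* With [lgen L V = - W] the dissipation is [G2 + W V + V W]; these mixed products cancel those of
   the expanded square. *)
have := aD x; rewrite /ldiss -aV.
have -> : lgen L V = - W by rewrite opprK.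
clearbody W; move: (lgen L (V *m V)) => G2.
rewrite mulNmx mulmxN !opprK !(qfD, qfN, qfZ) => hD.
have := aW (adjoint (s%:C *: 1%:M - s^-1%:C *: V) *m x).
rewrite -qf_conj adjointD adjointN !adjointZ adjoint1 -aV !conjc_real.
rewrite !mulmxBr !mulmxBl -!scalemxAr -!scalemxAl !mul1mx !mulmx1.
rewrite !(qfD, qfN, qfZ) => hW.
have s2 : 0 <= s ^- 2 by rewrite invr_ge0 sqr_ge0.
have hq := ler_wpM2l s2 (qf_le x (V *m W *m V)).
have sn : s != 0 by rewrite gt_eqF.
move: hW; rewrite (mulVKf sn) (mulKf sn) !mulrA -invfM -!expr2.
move: hq hD; rewrite mulrA; clear.
move: (qf x G2) (qf x W) (qf x V) (qf x (W *m V)) (qf x (V *m W)) (s ^+ 2)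
  (s ^- 2 * qf x _) (s ^- 2 * l1norm _ * _) => *.
lra.
Qed.

Lemma psd_accretive (R : realType) (n : nat) (M : 'M[R[i]]_n) : psd_op M -> accretive M.
Proof. by move=> /psd_opP[]. Qed.

Lemma le0_of_mul_sqr_le (R : realType) (a B : R) : 0 <= B ->
  (forall s, 0 < s -> a <= s ^- 2 * B) -> a <= 0.
Proof.
move=> B0 aB; rewrite leNgt; apply/negP => a0.
(* Then [s * a = B + a] and [s >= 1], so [a * s ^+ 2 >= B + a > B]. *)
pose s := B / a + 1.
have s1 : 1 <= s by rewrite /s lerDr divr_ge0 // ltW.
have s0 : 0 < s by exact: lt_le_trans ltr01 s1.
have := aB s s0; rewrite mulrC ler_pdivlMr ?exprn_gt0 // leNgt => /negP; apply.
have sa : s * a = B + a by rewrite /s mulrDl mul1r divfK // gt_eqF.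
have -> : a * s ^+ 2 = (B + a) * s by rewrite -sa; ring.
by apply: (@lt_le_trans _ _ (B + a)); rewrite ?ltrDl // ler_peMr // addr_ge0 // ltW.
Qed.

(** * Convergence under either condition *)

Unset Implicit Arguments.

Theorem theorem13 (R : realType) (n K : nat) (H : 'M[R[i]]_n)
    (L : 'I_K -> 'M[R[i]]_n) (V : 'M[R[i]]_n) (rho : R -> 'M[R[i]]_n) :
  H = adjoint H ->
  lyapunov L V ->
  H *m V = V *m H ->
  ((exists c : R, 0 < c /\ op_le (lgen L V) (- (Complex c 0 *: V))) \/
   (op_le (lgen L V) 0 /\
    exists c : R, 0 < c /\ op_le (Complex c 0 *: V) (ldiss L V))) ->
  density_state (rho 0) ->
  solves_lindblad H L rho ->
  forall sigma : 'M[R[i]]_n, traj_limit_point rho sigma -> ZV V sigma.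
Proof.
move=> eH [aV pV _ GV] HV cond dens0 sol sigma lim.
have dens := density_lindblad eH sol dens0.
have [psig trsig] := density_limit_point lim dens.
split=> //.
have aW : accretive (- lgen L V) by have := psd_accretive GV; rewrite sub0r.
have [_ aiV aNiV] := (psd_opP V).1 pV.
(* Disposes of the imaginary part of the trace; what remains is that its real part is at most 0. *)
have Im0 : rtr ('i *: V) sigma = 0.
  apply/eqP; rewrite eq_le (rtr_ge0 aiV psig) andbT -oppr_ge0 -rtrNl.
  exact: rtr_ge0 aNiV psig.
have Re0 := rtr_ge0 (psd_accretive pV) psig.
rewrite tr_rtr Im0 oppr0; apply/eqP; rewrite eq_complex /= eqxx andbT.
rewrite eq_le Re0 andbT.
have HNV : H *m (- V) = - V *m H by rewrite mulmxN mulNmx HV.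
have GNV : lgen L (- V) = - lgen L V by rewrite -scaleN1r lgenZ scaleN1r.
(* The value at [rho t] bounds all later values from above, hence also the value at the limit
   point. *)
have lV (t : R) : 0 <= t -> rtr V sigma <= rtr V (rho t).
  move=> t0; rewrite -lerN2 -(rtrNl V sigma).
  apply: (limit_point_ge (T := t) lim) => s ts.
  have k0 (r : R) : 0 <= r -> 0 <= rtr (lgen L (- V)) (rho r).
    by move=> r0; rewrite GNV; apply: rtr_ge0 => //; exact: (dens r r0).1.
  by have := observable_ge sol HNV k0 t0 ts; rewrite mul0r addr0 (rtrNl V (rho t)).
case: cond => [[c [c0 ES]]|[_ [c [c0 DS]]]].
  (* With [X = - V] and [b = 0] the required inequality is ES itself. *)
  have aX : accretive (lgen L (- V) - c%:C *: V + 0%:C *: 1%:M).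
    by rewrite GNV scale0r addr0 addrC; exact: psd_accretive.
  have := lyapunov_bound sol dens HNV (ltW c0) aX lV.
  by rewrite pmulr_rle0.
rewrite -(pmulr_rle0 _ c0).
(* Under DS each [s] gives a bound of order [s ^- 2] on [c] times the limit value, with a constant
   independent of [s]. *)
apply: (le0_of_mul_sqr_le (l1norm_ge0 (V *m (- lgen L V) *m V))) => s s0.
have aX := dissipation_bound s0 aV aW (psd_accretive DS).
apply: (lyapunov_bound sol dens _ (ltW c0) aX lV).
rewrite mulmxBr mulmxBl -scalemxAr -scalemxAl HV.
by rewrite mulmxA HV -mulmxA HV mulmxA.
Qed.
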